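(* Fix an integer $n\geq 1$. Let $X_n=[a_0,\overline{a_1,a_2}]$ be a continued fraction of type $(1,2)$ with $a_0,a_1,a_2\in\mathbb{Z}[X_{n-1}]$. Then there exists $\varepsilon\in RE_n^+$ such that $a_0=(p(\varepsilon)-1)/q(\varepsilon)$, $a_1=q(\varepsilon)$, $a_2=2(p(\varepsilon)-1)/q(\varepsilon)$, and $p(\varepsilon)q(\varepsilon)>0$. Conversely, if $\varepsilon\in RE_n^+$ satisfies $q(\varepsilon)\mid p(\varepsilon)-1$ in $\mathbb{Z}[X_{n-1}]$ and $p(\varepsilon)q(\varepsilon)>0$, then $$X_n=\left[\frac{p(\varepsilon)-1}{q(\varepsilon)},\overline{q(\varepsilon),\,2\frac{p(\varepsilon)-1}{q(\varepsilon)}}\right].$$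
   Context: For $m\geq 0$ let $X_m=2\cos(2\pi/2^{m+2})$ (so $X_0=0$ and $X_m=\sqrt{2+X_{m-1}}$), viewed as real numbers; $\mathbb{Z}[X_m]$ is the ring of integers of $\mathbb{Q}(X_m)$. Every $x\in\mathbb{Z}[X_n]$ can be written uniquely as $x=p(x)+X_nq(x)$ with $p(x),q(x)\in\mathbb{Z}[X_{n-1}]$. The relative norm is $N_{n/n-1}(x)=p(x)^2-X_n^2q(x)^2$, and $RE_n^+=\{\varepsilon\in\mathbb{Z}[X_n]: N_{n/n-1}(\varepsilon)=1\}$. For a sequence $c_0,c_1,\dots$ in $\mathbb{Z}[X_{n-1}]$ define $p_k,q_k$ by $\begin{pmatrix}p_k & p_{k-1}\\ q_k & q_{k-1}\end{pmatrix}=\begin{pmatrix}c_0&1\\1&0\end{pmatrix}\cdots\begin{pmatrix}c_k&1\\1&0\end{pmatrix}$; $[c_0,c_1,\dots]$ denotes the real limit of $p_k/q_k$, and ''$X_n=[c_0,c_1,\dots]$'' means this limit exists and equals $X_n$. The notation $[c_0,\overline{c_1,c_2}]$ means the sequence $c_0,c_1,c_2,c_1,c_2,\dots$; a periodic sequence has type $(N,\ell)$ if $N\geq0$, $\ell\geq1$ are minimal with $c_{k+\ell}=c_k$ for all $k\geq N$. *)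

(* Defs.v *)
From mathcomp Require Import all_boot all_order all_algebra.
From mathcomp Require Import all_classical all_reals all_analysis.

Set Implicit Arguments.
Unset Strict Implicit.
Unset Printing Implicit Defensive.

Import Order.TTheory GRing.Theory Num.Theory.
Import numFieldNormedType.Exports.

Local Open Scope classical_set_scope.
Local Open Scope ring_scope.

Definition Xm {R : realType} (m : nat) : R := 2 * cos (2 * pi / 2 ^+ (m + 2)).

Definition Zadj {R : realType} (x : R) : set R :=
  [set (map_poly intr P).[x] | P in [set: {poly int}]].

(* For 0 < n and x in Z[X_n] such a pair exists and is unique, because X_n has
   degree 2 over Q(X_(n-1)) and X_n ^+ 2 = 2 + X_(n-1); the default (0, 0)
   is used only for x outside Z[X_n]. *)
Definition reldec {R : realType} (n : nat) (x : R) : R * R :=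
  xget (0, 0) [set u | [/\ Zadj (Xm n.-1) u.1, Zadj (Xm n.-1) u.2
                         & x = u.1 + Xm n * u.2]].

Definition pcoef {R : realType} (n : nat) (x : R) : R := (reldec n x).1.

Definition qcoef {R : realType} (n : nat) (x : R) : R := (reldec n x).2.

Definition relnorm {R : realType} (n : nat) (x : R) : R :=
  pcoef n x ^+ 2 - Xm n ^+ 2 * qcoef n x ^+ 2.

Definition REp {R : realType} (n : nat) : set R :=
  [set e | Zadj (Xm n) e /\ relnorm n e = 1].

Definition dvd_in {R : realType} (A : set R) (a b : R) : Prop :=
  exists2 d, A d & b = a * d.

Definition cf_step {R : realType} (c : R) : 'M[R]_2 :=
  \matrix_(i < 2, j < 2) nth 0 (nth [::] [:: [:: c; 1]; [:: 1; 0]] i) j.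

Definition cf_mx {R : realType} (c : nat -> R) (k : nat) : 'M[R]_2 :=
  \prod_(i < k.+1) cf_step (c i).

Definition cf_num {R : realType} (c : nat -> R) (k : nat) : R :=
  cf_mx c k 0 0.

Definition cf_den {R : realType} (c : nat -> R) (k : nat) : R :=
  cf_mx c k 1 0.

(* x = [c_0, c_1, ...]. Since y / 0 = 0 in R, the first conjunct is needed for
   the quotients to be meaningful; finitely many q_k may vanish. *)
Definition cf_eq {R : realType} (x : R) (c : nat -> R) : Prop :=
  (\forall k \near \oo, cf_den c k != 0) /\
  (fun k => cf_num c k / cf_den c k) @ \oo --> x.

Definition periodic_from {T : Type} (c : nat -> T) (N l : nat) : Prop :=
  (1 <= l)%N /\ forall k, (N <= k)%N -> c (k + l)%N = c k.

Definition periodic_type {T : Type} (c : nat -> T) (N l : nat) : Prop :=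
  periodic_from c N l /\
  forall N' l', periodic_from c N' l' -> (N <= N')%N /\ (l <= l')%N.

Definition seq12 {T : Type} (c0 c1 c2 : T) (k : nat) : T :=
  if k == 0%N then c0 else if odd k then c1 else c2.

(* Main.v *)
Require Import Defs.
From mathcomp Require Import all_boot all_order all_algebra.
From mathcomp Require Import all_classical all_reals all_analysis.
From mathcomp Require Import ring lra.

Import Order.TTheory GRing.Theory Num.Theory.
Import numFieldNormedType.Exports.

Local Open Scope classical_set_scope.
Local Open Scope ring_scope.

(* Write X for X_n, C(a) for the step matrix, M = C(a_1) C(a_2) and
   E = C(a_0) M C(a_0)^-1.  The convergents satisfy (p_(k+2), q_(k+2)) =
   E (p_k, q_k), so the limit X is a fixed point of the homography E.  As X has
   degree 2 over Q(X_(n-1)), this forces E = [[p, X^2 q], [q, p]] with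
   determinant p^2 - X^2 q^2 = 1; comparing entries gives a_1 = q,
   a_0 a_1 = p - 1 and a_2 = 2 a_0, and eps = p + X q is the required unit.  The
   eigenvalues of E are eps (eigenvector (X, 1)) and eps^-1 (eigenvector (-X, 1)),
   so the convergents tend to X if and only if |eps| > |eps^-1|, i.e. p q > 0.

   The degree statement comes from Eisenstein's criterion at 2: X_n is a root of
   the n-fold iterate of X^2 - 2, which is even, so that -X_n is a conjugate of
   X_n and u + X_n v = 0 implies u - X_n v = 0. *)

(** * Irreducibility of the iterates of X^2 - 2 *)

Definition iter_sqr_sub2 (m : nat) : {poly int} :=
  iter m (fun f => f \Po ('X^2 - 2%:P)) 'X.

Lemma iter_sqr_sub2S m :
  iter_sqr_sub2 m.+1 = iter_sqr_sub2 m \Po ('X^2 - 2%:P).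
Proof. by []. Qed.

Lemma size_sqr_sub2 (A : idomainType) : size ('X^2 - 2%:P : {poly A}) = 3%N.
Proof. by rewrite size_XnsubC. Qed.

Lemma size_iter_sqr_sub2 m : size (iter_sqr_sub2 m) = (2 ^ m).+1.
Proof.
elim: m => [|m IH] /=; first by rewrite size_polyX.
have szg : size ('X^2 - 2%:P : {poly int}) = 3%N := @size_sqr_sub2 _.
have := size_comp_poly (iter_sqr_sub2 m) ('X^2 - 2%:P).
rewrite IH szg /= -expnSr => <-.
rewrite prednK // size_poly_gt0 comp_poly_eq0 ?szg //.
by rewrite -size_poly_gt0 IH.
Qed.

Lemma lead_coef_iter_sqr_sub2 m : lead_coef (iter_sqr_sub2 m) = 1.
Proof.
elim: m => [|m IH] /=; first by rewrite lead_coefX.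
rewrite lead_coef_comp ?size_sqr_sub2 // IH mul1r lead_coefXnsubC //.
by rewrite expr1n.
Qed.

(** Since X^2 - 2 reduces to X^2 in characteristic 2, all coefficients below the leading one are
    even, as Eisenstein's criterion requires. *)
Lemma iter_sqr_sub2_mod2 m :
  map_poly (intr : int -> 'F_2) (iter_sqr_sub2 m) = 'X^(2 ^ m).
Proof.
elim: m => [|m IH] /=; first by rewrite map_polyX.
rewrite map_comp_poly IH rmorphB /= map_polyXn map_polyC /=.
have -> : (2%:~R : 'F_2) = 0 by apply/val_inj.
by rewrite subr0 comp_Xn_poly -exprM -expnS.
Qed.

Lemma horner_iter_sqr_sub2_2 m : (iter_sqr_sub2 m).[2] = 2.
Proof.
by elim: m => [|m IH] /=; rewrite ?hornerX // horner_comp !hornerE.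
Qed.

(** The map x^2 - 2 sends 0 to -2, then -2 to its fixed point 2; so 4 never divides the constant
    term. *)
Lemma coef0_iter_sqr_sub2 m :
  (iter_sqr_sub2 m.+1)`_0 = 2 \/ (iter_sqr_sub2 m.+1)`_0 = -2.
Proof.
rewrite -horner_coef0 /= horner_comp !hornerE ?expr0n /= ?sub0r ?mulr0.
case: m => [|m] /=; first by right; rewrite hornerX.
by left; rewrite horner_comp !hornerE horner_iter_sqr_sub2_2.
Qed.

Lemma irreducible_iter_sqr_sub2 m : irreducible_poly (iter_sqr_sub2 m.+1).
Proof.
apply: (@eisenstein_crit 2) => //.
- by rewrite size_iter_sqr_sub2 eqSS -lt0n expn_gt0.
- by rewrite lead_coef_iter_sqr_sub2.
- by case: (coef0_iter_sqr_sub2 m) => ->.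
move=> i; rewrite size_iter_sqr_sub2 /= => lti.
have := congr1 (fun f : {poly 'F_2} => f`_i) (iter_sqr_sub2_mod2 m.+1).
rewrite coef_map coefXn (ltn_eqF lti) /=.
move: (nth _ _ i) => z z0.
rewrite dvdzE /= (dvdn_pcharf (pchar_Fp (isT : prime 2))).
case: z z0 => k /= z0; rewrite ?absrzN -?pmulrn; apply/eqP => //.
by apply: oppr_inj; rewrite [RHS]oppr0 -[RHS]z0 NegzE mulrNz.
Qed.

(** Either [f] divides a nonzero integer multiple of [F], or a Bezout relation between them equals a
    nonzero constant, which evaluation at [x] contradicts. *)
Lemma irreducible_poly_conj_root (K : numFieldType) (f F : {poly int}) (x y : K) :
  irreducible_poly f ->
  root (map_poly intr f) x -> root (map_poly intr f) y ->
  root (map_poly intr F) x -> root (map_poly intr F) y.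
Proof.
move=> irf /rootP fx /rootP fy /rootP Fx.
have [/Pdiv.Idomain.dvdpP [[c g] /= c0 cF]|] := boolP (f %| F).
  have := congr1 (fun h => (map_poly (intr : int -> K) h).[y]) cF.
  rewrite map_polyZ rmorphM hornerZ hornerM fy mulr0 => /eqP.
  by rewrite mulf_eq0 intr_eq0 (negPf c0).
rewrite -irreducible_poly_coprime // => /Pdiv.Idomain.Bezout_coprimepP.
case=> -[u v] /=; rewrite -size_poly_eq1 => /size_poly1P [c c0 e].
have := congr1 (fun h => (map_poly (intr : int -> K) h).[x]) e.
rewrite rmorphD !rmorphM hornerD !hornerM fx Fx !mulr0 addr0 map_polyC hornerC.
by move/esym/eqP; rewrite intr_eq0 (negPf c0).
Qed.

(** * The numbers X_m and the decomposition of Z[X_(m+1)] over Z[X_m] *)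

Lemma Xm0 (R : realType) : Xm 0 = 0 :> R.
Proof.
rewrite /Xm add0n expr2 invfM mulrA [2 * pi]mulrC mulfK ?pnatr_eq0 //.
by rewrite cos_pihalf mulr0.
Qed.

Lemma XmS_sqr (R : realType) m : Xm m.+1 ^+ 2 = 2 + Xm m :> R.
Proof.
rewrite /Xm; set x := 2 * pi / 2 ^+ (m.+1 + 2).
have -> : 2 * pi / 2 ^+ (m + 2) = x *+ 2 :> R.
  rewrite /x addSn [2 ^+ (_).+1]exprS invfM -mulr_natl; field.
  by rewrite expf_neq0 // pnatr_eq0.
by rewrite cos_mulr2n; ring.
Qed.

Lemma XmS_gt0 (R : realType) m : 0 < Xm m.+1 :> R.
Proof.
rewrite /Xm mulr_gt0 //; apply: cos_gt0_pihalf.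
have pi0 := pi_gt0 R.
have h : 2 * pi / 2 ^+ (m.+1 + 2) = (pi / 2) / 2 ^+ m.+1 :> R.
  by rewrite exprD; field; rewrite expf_neq0 // pnatr_eq0.
have e2 : 1 < 2 ^+ m.+1 :> R by rewrite exprn_egt1 // ltr1n.
have e0 : 0 < 2 ^+ m.+1 :> R by rewrite exprn_gt0.
have h0 : 0 < pi / 2 / 2 ^+ m.+1 :> R by rewrite !divr_gt0.
rewrite h; apply/andP; split; first by rewrite (lt_trans _ h0) // oppr_lt0 divr_gt0.
by rewrite ltr_pdivrMr // ltr_pMr // divr_gt0.
Qed.

Lemma Xm_root (R : realType) m :
  root (map_poly intr (iter_sqr_sub2 m)) (Xm m : R).
Proof.
apply/rootP; elim: m => [|m IH] /=; first by rewrite map_polyX hornerX Xm0.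
rewrite map_comp_poly horner_comp rmorphB /= map_polyXn map_polyC !hornerE.
by rewrite XmS_sqr addrC addKr.
Qed.

Lemma map_intr_comp_sqr_sub2 (R : comNzRingType) (f : {poly int}) (x : R) :
  (map_poly intr (f \Po ('X^2 - 2%:P))).[x] = (map_poly intr f).[x ^+ 2 - 2].
Proof. by rewrite map_comp_poly horner_comp rmorphB /= map_polyXn map_polyC !hornerE. Qed.

Lemma Zadj_free (R : realType) m (u v : R) :
  Zadj (Xm m) u -> Zadj (Xm m) v -> u + Xm m.+1 * v = 0 -> u = 0 /\ v = 0.
Proof.
move=> [P _ <-] [Q _ <-]; set x := Xm m.+1.
have xE : Xm m = x ^+ 2 - 2 by rewrite XmS_sqr addrC addKr.
have x0 : x != 0 by rewrite gt_eqF // XmS_gt0.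
pose g : {poly int} := 'X^2 - 2%:P.
(* [F] takes the value u + x v at x and u - x v at -x. *)
pose F := P \Po g + 'X * (Q \Po g).
have FE (y : R) : (map_poly intr F).[y] =
    (map_poly intr P).[y ^+ 2 - 2] + y * (map_poly intr Q).[y ^+ 2 - 2].
  by rewrite rmorphD rmorphM /= hornerD hornerM !map_intr_comp_sqr_sub2 map_polyX hornerX.
rewrite xE -FE => Fx.
have /rootP : root (map_poly intr F) (- x).
  apply: (irreducible_poly_conj_root _ _ _ _ _ (irreducible_iter_sqr_sub2 m) (Xm_root _ _)).
    apply/rootP; have /rootP := Xm_root R m.+1.
    by rewrite iter_sqr_sub2S !map_intr_comp_sqr_sub2 sqrrN.
  exact/rootP.
move: Fx; rewrite !FE sqrrN.
set a := _.[_]; set b := _.[_] => h1 h2.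
have a0 : a = 0 by lra.
split=> //; move: h1; rewrite a0 add0r => /eqP.
by rewrite mulf_eq0 (negPf x0) => /eqP.
Qed.

Lemma Zadj_intr (R : realType) (x : R) (z : int) : Zadj x z%:~R.
Proof. by exists z%:P; rewrite // map_polyC hornerC. Qed.

Lemma Zadj_id (R : realType) (x : R) : Zadj x x.
Proof. by exists 'X; rewrite // map_polyX hornerX. Qed.

Lemma ZadjD (R : realType) (x u v : R) : Zadj x u -> Zadj x v -> Zadj x (u + v).
Proof. by move=> [P _ <-] [Q _ <-]; exists (P + Q); rewrite // rmorphD hornerD. Qed.

Lemma ZadjM (R : realType) (x u v : R) : Zadj x u -> Zadj x v -> Zadj x (u * v).
Proof. by move=> [P _ <-] [Q _ <-]; exists (P * Q); rewrite // rmorphM hornerM. Qed.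

Lemma ZadjN (R : realType) (x u : R) : Zadj x u -> Zadj x (- u).
Proof. by move=> [P _ <-]; exists (- P); rewrite // rmorphN hornerN. Qed.

Lemma ZadjB (R : realType) (x u v : R) : Zadj x u -> Zadj x v -> Zadj x (u - v).
Proof. by move=> xu xv; apply/ZadjD/ZadjN. Qed.

Lemma Zadj_XmS (R : realType) m (u : R) : Zadj (Xm m) u -> Zadj (Xm m.+1) u.
Proof.
move=> [P _ <-]; exists (P \Po ('X^2 - 2%:P)) => //.
by rewrite map_intr_comp_sqr_sub2 XmS_sqr addrC addKr.
Qed.

(** Two decompositions of one number differ by a relation to which [Zadj_free] applies; hence
    [pcoef] and [qcoef] can be read off any decomposition. *)
Lemma reldecE (R : realType) m (u v : R) :
  Zadj (Xm m) u -> Zadj (Xm m) v -> reldec m.+1 (u + Xm m.+1 * v) = (u, v).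
Proof.
move=> Au Av; apply: xget_unique => //= -[u' v'] [/= Au' Av' e].
have e0 : u' - u + Xm m.+1 * (v' - v) = 0.
  by rewrite mulrBr addrACA -opprD -e subrr.
have [/subr0_eq -> /subr0_eq -> //] :=
  Zadj_free R m _ _ (ZadjB _ _ _ _ Au' Au) (ZadjB _ _ _ _ Av' Av) e0.
Qed.

(** * Convergents of [a0, a1, a2, a1, a2, ...] *)

Lemma cf_mxS (R : realType) (c : nat -> R) k :
  cf_mx c k.+1 = cf_mx c k * cf_step (c k.+1).
Proof. by rewrite /cf_mx big_ord_recr. Qed.

Lemma cf_mxS0 (R : realType) (c : nat -> R) k i :
  cf_mx c k.+1 i 0 = cf_mx c k i 0 * c k.+1 + cf_mx c k i 1.
Proof.
rewrite cf_mxS !mxE big_ord_recl big_ord1 /= !mxE /= mulr1.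
by congr (_ + cf_mx c k i _); apply/val_inj.
Qed.

Lemma cf_mxS1 (R : realType) (c : nat -> R) k i : cf_mx c k.+1 i 1 = cf_mx c k i 0.
Proof. by rewrite cf_mxS !mxE big_ord_recl big_ord1 !mxE /= mulr1 mulr0 addr0. Qed.

Lemma cf_mxSS0 (R : realType) (c : nat -> R) k i :
  cf_mx c k.+2 i 0 = cf_mx c k.+1 i 0 * c k.+2 + cf_mx c k i 0.
Proof. by rewrite cf_mxS0 cf_mxS1. Qed.

Lemma cf_mx0 (R : realType) (c : nat -> R) : cf_mx c 0 = cf_step (c 0%N).
Proof. by rewrite /cf_mx big_ord_recl big_ord0 mulr1. Qed.

(* The matrix of coefficients is [C M C^-1], with [C = cf_step a0] and
   [M = cf_step a1 * cf_step a2]. *)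
Lemma cf_seq12_period (R : realType) (a0 a1 a2 : R) k (c := seq12 a0 a1 a2) :
  cf_num c k.+2 = (a0 * a1 + 1) * cf_num c k
                  + (a0 * a1 * a2 + a2 - a0 ^+ 2 * a1) * cf_den c k /\
  cf_den c k.+2 = a1 * cf_num c k + (a1 * a2 + 1 - a0 * a1) * cf_den c k.
Proof.
rewrite /cf_num /cf_den.
(* As [c] has period 2 from index 1, the convergents of index k and k + 2 obey the same three-term
   recurrence; the cases 0 and 1 start it. *)
elim/ltn_ind: k => -[|[|k]] IH.
- by rewrite !cf_mxSS0 !cf_mxS0 !cf_mx0 !mxE /c /seq12 /=; split; ring.
- by rewrite !cf_mxSS0 !cf_mxS0 !cf_mx0 !mxE /c /seq12 /=; split; ring.
have [n0 d0] := IH k (ltnW (ltnSn _)); have [n1 d1] := IH k.+1 (ltnSn _).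
have cE : c k.+4 = c k.+2 by rewrite /c /seq12 /= !negbK.
split; rewrite (cf_mxSS0 _ _ k.+2) cE.
  by rewrite n1 [X in _ + X = _]n0 !(cf_mxSS0 _ _ k); ring.
by rewrite d1 [X in _ + X = _]d0 !(cf_mxSS0 _ _ k); ring.
Qed.

(** The period matrix relates only indices of equal parity, so even and odd convergents are treated
    separately and then joined. *)
Lemma near_infty_parity (P : nat -> Prop) :
  (\forall k \near \oo, P k.*2) -> (\forall k \near \oo, P k.*2.+1) ->
  \forall k \near \oo, P k.
Proof.
move=> [N1 _ P1] [N2 _ P2]; exists (maxn N1 N2).*2 => //= k hk.
have h : (maxn N1 N2 <= k./2)%N by rewrite -(doubleK (maxn N1 N2)) half_leq.
rewrite -(odd_double_half k); case: odd; [apply: P2|apply: P1] => /=.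
  exact: leq_trans (leq_maxr _ _) h.
exact: leq_trans (leq_maxl _ _) h.
Qed.

Lemma cvg_infty_parity (R : realType) (u : nat -> R) (l : R) :
  u k.*2 @[k --> \oo] --> l -> u k.*2.+1 @[k --> \oo] --> l -> u @ \oo --> l.
Proof.
move=> /cvgrPdist_lt u0 /cvgrPdist_lt u1; apply/cvgrPdist_lt => e e0.
exact: (near_infty_parity (fun k => `|l - u k| < e) (u0 e e0) (u1 e e0)).
Qed.

(** * Orbits of homographies and their limits, in the eigencoordinates [P + X Q] and [P - X Q] *)

Lemma pell_orbitE (R : realType) (X p q : R) (P Q : nat -> R) :
  (forall k, P k.+1 = p * P k + X ^+ 2 * q * Q k /\ Q k.+1 = q * P k + p * Q k) ->
  forall k, P k + X * Q k = (p + X * q) ^+ k * (P 0%N + X * Q 0%N) /\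
            P k - X * Q k = (p - X * q) ^+ k * (P 0%N - X * Q 0%N).
Proof.
move=> rec; elim=> [|k [IHp IHm]]; first by rewrite !expr0 !mul1r.
have [-> ->] := rec k.
by rewrite !exprS -!mulrA -IHp -IHm; split; ring.
Qed.

(* [w k = (P k - X Q k) / (P k + X Q k)] is the image of [P k / Q k] under the
   Moebius map sending [X] to [0] and [- X] to [oo]. *)
Lemma pell_orbit_ratio (R : realType) (X p q : R) (P Q : nat -> R) :
  p ^+ 2 - X ^+ 2 * q ^+ 2 = 1 ->
  (forall k, P k.+1 = p * P k + X ^+ 2 * q * Q k /\ Q k.+1 = q * P k + p * Q k) ->
  P 0%N + X * Q 0%N != 0 ->
  forall k, P k + X * Q k != 0 /\
    (P k - X * Q k) / (P k + X * Q k) =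
    (P 0%N - X * Q 0%N) / (P 0%N + X * Q 0%N) * ((p - X * q) ^+ 2) ^+ k.
Proof.
move=> N1 rec s0 k; have [-> ->] := pell_orbitE _ _ _ _ _ _ rec k.
have e1 : (p + X * q) * (p - X * q) = 1 by rewrite -N1; ring.
have e0 : p + X * q != 0.
  by apply: contra_eq_neq e1 => ->; rewrite mul0r eq_sym oner_eq0.
have -> : p - X * q = (p + X * q)^-1 by rewrite -[LHS](mulKf e0) e1 mulr1.
move: (p + X * q) e0 => e e0; split; first by rewrite mulf_neq0 ?expf_neq0.
rewrite -exprM mulnC exprM expr2 !exprVn; field.
by rewrite s0 expf_neq0.
Qed.

(** The squares u of p + X q and t of p - X q satisfy t u = 1 and u - t = 4 X p q; so p q > 0 means
    t < u, that is, t < 1. *)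
Lemma pell_small_conj (R : realType) (X p q : R) : 0 < X ->
  p ^+ 2 - X ^+ 2 * q ^+ 2 = 1 -> (0 < p * q) = ((p - X * q) ^+ 2 < 1).
Proof.
move=> X0 N1; set t := (p - X * q) ^+ 2.
have tu : t * (p + X * q) ^+ 2 = 1.
  by rewrite /t -exprMn -[RHS](expr1n _ 2) -N1; congr (_ ^+ 2); ring.
have d : (p + X * q) ^+ 2 - t = 4 * X * (p * q) by rewrite /t; ring.
have t0 : 0 <= t by rewrite sqr_ge0.
have X4 : 0 < 4 * X by rewrite mulr_gt0.
rewrite -(pmulr_rgt0 _ X4) -d; move: ((p + X * q) ^+ 2) tu => u tu.
by apply/idP/idP => h; nra.
Qed.

(** The ratio [w] tends to 0 geometrically, and P / Q = X (1 + w) / (1 - w). *)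
Lemma pell_orbit_cvg (R : realType) (X p q : R) (P Q : nat -> R) : 0 < X ->
  p ^+ 2 - X ^+ 2 * q ^+ 2 = 1 ->
  (forall k, P k.+1 = p * P k + X ^+ 2 * q * Q k /\ Q k.+1 = q * P k + p * Q k) ->
  P 0%N + X * Q 0%N != 0 -> 0 < p * q ->
  (\forall k \near \oo, Q k != 0) /\ P k / Q k @[k --> \oo] --> X.
Proof.
move=> X0 N1 rec s0; rewrite (pell_small_conj _ _ _ _ X0 N1) => t1.
pose w k := (P k - X * Q k) / (P k + X * Q k).
have w0 : w @ \oo --> 0.
  have -> : w = geometric ((P 0%N - X * Q 0%N) / (P 0%N + X * Q 0%N)) ((p - X * q) ^+ 2).
    apply/funext => k; rewrite /w.
    by have [_ ->] := pell_orbit_ratio _ _ _ _ _ _ N1 rec s0 k.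
  by apply: cvg_geometric; rewrite ger0_norm ?sqr_ge0.
have Xn0 : X != 0 by rewrite gt_eqF.
have QE k : 1 - w k = 2 * X * Q k / (P k + X * Q k).
  have [sk _] := pell_orbit_ratio _ _ _ _ _ _ N1 rec s0 k.
  by rewrite /w; field.
have PE k : 1 + w k = 2 * P k / (P k + X * Q k).
  have [sk _] := pell_orbit_ratio _ _ _ _ _ _ N1 rec s0 k.
  by rewrite /w; field.
have w1 : 1 - w k @[k --> \oo] --> (1 - 0 : R) by apply: cvgB w0; apply: cvg_cst.
split.
  have := cvgr_neq0 _ w1; rewrite subr0 oner_eq0 => /(_ _ isT).
  apply: filterS => k; rewrite QE; apply: contra_neq => ->.
  by rewrite mulr0 mul0r.
have -> : (fun k => P k / Q k) = (fun k => X * ((1 + w k) / (1 - w k))).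
  apply/funext => k; rewrite PE QE.
  have [sk _] := pell_orbit_ratio _ _ _ _ _ _ N1 rec s0 k.
  (* Where [Q k] vanishes, both sides are 0 by the convention y / 0 = 0. *)
  have [->|Q0] := eqVneq (Q k) 0; first by rewrite !(mulr0, mul0r, invr0).
  by field; rewrite sk Q0.
have {2}-> : X = X * ((1 + 0) / (1 - 0)) by rewrite addr0 subr0 divr1 mulr1.
apply: cvgM; first exact: cvg_cst.
apply: cvgM; first by apply: cvgD w0; apply: cvg_cst.
by apply: cvgV w1; rewrite subr0 oner_neq0.
Qed.

(** Convergence to [X] forces [w] to tend to 0, whereas (p - X q)^2 >= 1 would keep |w k| >= |w 0| >
    0. *)
Lemma pell_orbit_cvg_gt0 (R : realType) (X p q : R) (P Q : nat -> R) : 0 < X ->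
  p ^+ 2 - X ^+ 2 * q ^+ 2 = 1 ->
  (forall k, P k.+1 = p * P k + X ^+ 2 * q * Q k /\ Q k.+1 = q * P k + p * Q k) ->
  P 0%N + X * Q 0%N != 0 -> P 0%N - X * Q 0%N != 0 ->
  (\forall k \near \oo, Q k != 0) -> P k / Q k @[k --> \oo] --> X -> 0 < p * q.
Proof.
move=> X0 N1 rec s0 t0 Qn0 PQ; rewrite (pell_small_conj _ _ _ _ X0 N1) ltNge.
apply/negP => t1.
pose w k := (P k - X * Q k) / (P k + X * Q k).
have w0 : w @ \oo --> (X - X) / (X + X).
  have X2 : X + X != 0 by rewrite gt_eqF // addr_gt0.
  have : (P k / Q k - X) / (P k / Q k + X) @[k --> \oo] --> (X - X) / (X + X).
    apply: cvgM; first by apply: cvgB PQ _; apply: cvg_cst.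
    by apply: cvgV X2 _; apply: cvgD PQ _; apply: cvg_cst.
  apply: cvg_trans; apply: near_eq_cvg.
  apply: filterS Qn0 => k Q0.
  have [sk _] := pell_orbit_ratio _ _ _ _ _ _ N1 rec s0 k.
  by rewrite /w; field; rewrite sk Q0.
set c := (P 0%N - X * Q 0%N) / (P 0%N + X * Q 0%N).
have c0 : 0 < `|c| by rewrite normr_gt0 mulf_neq0 ?invr_neq0.
move: w0; rewrite subrr mul0r => /cvgr_dist_lt /(_ _ c0) [k _ /(_ k (leqnn k))] /=.
rewrite /w; have [_ ->] := pell_orbit_ratio _ _ _ _ _ _ N1 rec s0 k.
rewrite sub0r normrN normrM ltNge => /negP; apply.
have tk : 1 <= ((p - X * q) ^+ 2) ^+ k by exact: exprn_ege1.
by rewrite ler_peMr // ger0_norm // (le_trans ler01).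
Qed.

(** With r = P / Q, the recurrence reads r_(k+1) (c r_k + d) = a r_k + b for large k; both sides
    pass to the limit. *)
Lemma cvg_homography_fixpoint (R : realType) (P Q : nat -> R) (a b c d x : R) :
  (forall k, P k.+1 = a * P k + b * Q k /\ Q k.+1 = c * P k + d * Q k) ->
  (\forall k \near \oo, Q k != 0) -> P k / Q k @[k --> \oo] --> x ->
  x * (c * x + d) = a * x + b.
Proof.
move=> rec Q0 PQ; apply/eqP; rewrite -subr_eq0; apply/eqP.
pose r k := P k / Q k.
have rS : r k.+1 @[k --> \oo] --> x by rewrite cvg_shiftS.
have cM (y : R) : y * r k @[k --> \oo] --> y * x by apply: cvgM PQ; apply: cvg_cst.
have lim : r k.+1 * (c * r k + d) - (a * r k + b) @[k --> \oo] -->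
    x * (c * x + d) - (a * x + b).
  have aff (y z : R) : y * r k + z @[k --> \oo] --> y * x + z.
    by apply: cvgD; [exact: cM|exact: cvg_cst].
  by apply: cvgB; [apply: (cvgM rS)|].
apply: (cvg_unique _ lim) => //.
suff : (fun=> 0) @ \oo --> (0 : R).
  apply: cvg_trans; apply: near_eq_cvg.
  have QS : \forall k \near \oo, Q k.+1 != 0.
    by have [N _ QN] := Q0; exists N => // k /= Nk; apply: QN; exact: leqW.
  near=> k.
  have Qk : Q k != 0 by near: k.
  have : Q k.+1 != 0 by near: k.
  rewrite /r; have [-> ->] := rec k => QSk.
  by field; rewrite Qk QSk.
exact: cvg_cst.
Unshelve. all: by end_near.
Qed.

Theorem theorem3p1 (R : realType) (n : nat) (hn : (1 <= n)%N) :
  (forall a0 a1 a2 : R,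
     Zadj (Xm n.-1) a0 -> Zadj (Xm n.-1) a1 -> Zadj (Xm n.-1) a2 ->
     periodic_type (seq12 a0 a1 a2) 1 2 ->
     cf_eq (Xm n) (seq12 a0 a1 a2) ->
     exists2 e : R, REp n e &
       [/\ a0 = (pcoef n e - 1) / qcoef n e,
           a1 = qcoef n e,
           a2 = 2 * ((pcoef n e - 1) / qcoef n e)
         & 0 < pcoef n e * qcoef n e])
  /\
  (forall e : R,
     REp n e ->
     dvd_in (Zadj (Xm n.-1)) (qcoef n e) (pcoef n e - 1) ->
     0 < pcoef n e * qcoef n e ->
     cf_eq (Xm n) (seq12 ((pcoef n e - 1) / qcoef n e)
                        (qcoef n e)
                        (2 * ((pcoef n e - 1) / qcoef n e)))).
Proof.
case: n hn => // m _; rewrite /=; set X := Xm m.+1.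
have X0 : 0 < X by exact: XmS_gt0.
have AX2 : Zadj (Xm m) (X ^+ 2).
  by rewrite XmS_sqr; apply: ZadjD (Zadj_id _ _); exact: (Zadj_intr _ _ 2).
have A1 : Zadj (Xm m) (1 : R) by exact: (Zadj_intr _ _ 1).
split=> [a0 a1 a2 A0 Aa1 A2 [_ cmin] [den0 cvg] | e [_]]; last first.
  rewrite /relnorm -/X; set p := pcoef _ _; set q := qcoef _ _ => N1 _ pq.
  set a0 := (p - 1) / q.
  have q0 : q != 0 by apply: contraTneq pq => ->; rewrite mulr0 ltxx.
  (* The norm equation solved for X^2; it gives the period matrix the form [[p, X^2 q], [q, p]]. *)
  have X2 : X ^+ 2 = (p ^+ 2 - 1) / q ^+ 2.
    by rewrite -[X in _ - X]N1 opprB addrC subrK mulfK ?expf_neq0.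
  have n0 : p + X * q != 0.
    apply: contra_eq_neq N1 => h.
    have -> : p ^+ 2 - X ^+ 2 * q ^+ 2 = (p + X * q) * (p - X * q) by ring.
    by rewrite h mul0r eq_sym oner_eq0.
  have t1 : (p - X * q) ^+ 2 < 1 by rewrite -(pell_small_conj _ _ _ _ X0 N1).
  have tu : (p + X * q) * (p - X * q) = 1 by rewrite -[RHS]N1; ring.
  set c := seq12 _ _ _.
  have rec k : cf_num c k.+2 = p * cf_num c k + X ^+ 2 * q * cf_den c k /\
               cf_den c k.+2 = q * cf_num c k + p * cf_den c k.
    have [-> ->] := cf_seq12_period _ a0 q (2 * a0) k.
    by rewrite X2 /a0; split; field.
  have [] := pell_orbit_cvg _ _ _ _ (fun k => cf_num c k.*2) (fun k => cf_den c k.*2)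
    X0 N1 (fun k => rec k.*2) _ pq.
    (* The even orbit starts at a0 + X = (eps - 1) / q, and eps = 1 would give p - X q = 1, against
       [t1]. *)
    rewrite /cf_num /cf_den !cf_mx0 !mxE /= mulr1 /c /seq12 /= /a0.
    have -> : (p - 1) / q + X = (p + X * q - 1) / q by field.
    rewrite mulf_neq0 ?invr_neq0 // subr_eq0.
    by apply: contraTneq t1 => h; move: tu; rewrite h mul1r => ->; rewrite expr1n ltxx.
  move=> de ce.
  have [] := pell_orbit_cvg _ _ _ _ (fun k => cf_num c k.*2.+1)
    (fun k => cf_den c k.*2.+1) X0 N1 (fun k => rec k.*2.+1) _ pq.
    (* The odd orbit starts at (p, q), where the eigencoordinate is eps itself. *)
    rewrite /cf_num /cf_den !cf_mxS0 !cf_mx0 !mxE /= /c /seq12 /= /a0 mul1r addr0.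
    by have -> : (p - 1) / q * q + 1 + X * q = p + X * q by field.
  move=> dod codd; split; first exact: near_infty_parity.
  exact: cvg_infty_parity.
set c := seq12 a0 a1 a2 in cmin den0 cvg.
have d2 : k.*2 @[k --> \oo] --> \oo.
  by rewrite (eq_cvg _ _ (fun k => esym (mul2n k))); exact: cvg_mulnl.
(* For the direct statement the even convergents suffice. *)
pose P k := cf_num c k.*2; pose Q k := cf_den c k.*2.
have den0e : \forall k \near \oo, Q k != 0 by exact: d2 den0.
have cvge : P k / Q k @[k --> \oo] --> X by exact: (cvg_comp _ _ d2 cvg).
have fixX := cvg_homography_fixpoint _ P Q _ _ _ _ _
  (fun k => cf_seq12_period _ a0 a1 a2 k.*2) den0e cvge.
have A01 : Zadj (Xm m) (a0 * a1) by exact: ZadjM.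
have A12 : Zadj (Xm m) (a1 * a2) by exact: ZadjM.
(* The fixed-point equation is a relation u + X v = 0 over Z[X_(n-1)], because X^2 lies there; [eb]
   compares the off-diagonal entries and [ea] the diagonal ones. *)
have [eb ea] : X ^+ 2 * a1 - (a0 * a1 * a2 + a2 - a0 ^+ 2 * a1) = 0 /\
    a1 * a2 + 1 - a0 * a1 - (a0 * a1 + 1) = 0.
  apply: (Zadj_free R m).
  - apply: ZadjB; first exact: ZadjM.
    apply: ZadjB; last by rewrite expr2; do 2![apply: ZadjM => //].
    by apply: ZadjD => //; apply: ZadjM.
  - by apply: ZadjB; [apply: ZadjB => //|]; apply: ZadjD.
  have := fixX; rewrite -/X; move/eqP; rewrite -subr_eq0 => /eqP <-; ring.
(* If a1 = 0, then [eb] gives a2 = 0 and the sequence has period 1 from index 1, against the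
   minimality of 2. *)
have a1n0 : a1 != 0.
  apply/eqP => a10.
  have a20 : a2 = 0.
    by move: eb; rewrite a10 !(mulr0, mul0r) sub0r subr0 add0r => /eqP; rewrite oppr_eq0 => /eqP.
  suff : (2 <= 1)%N by [].
  apply: (cmin 1%N 1%N _).2; split=> // -[|k] // _.
  by rewrite /c /seq12 a10 a20 /= !if_same.
have a2E : a2 = 2 * a0.
  by apply: (mulfI a1n0); apply/eqP; rewrite -subr_eq0 -ea; apply/eqP; ring.
pose p := a0 * a1 + 1.
have pcf : pcoef m.+1 (p + X * a1) = p by rewrite /pcoef reldecE //; exact: ZadjD.
have qcf : qcoef m.+1 (p + X * a1) = a1 by rewrite /qcoef reldecE //; exact: ZadjD.
have X2 : X ^+ 2 * a1 = a0 ^+ 2 * a1 + 2 * a0.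
  by apply/eqP; rewrite -subr_eq0 -eb a2E; apply/eqP; ring.
have N1 : p ^+ 2 - X ^+ 2 * a1 ^+ 2 = 1.
  by rewrite [a1 ^+ 2]expr2 mulrA X2 /p; ring.
exists (p + X * a1).
  split; last by rewrite /relnorm pcf qcf.
  apply: ZadjD; first by apply: Zadj_XmS; exact: ZadjD.
  by apply: ZadjM; [exact: Zadj_id|exact: Zadj_XmS].
rewrite pcf qcf /p; split=> //; rewrite ?addrK ?mulfK //.
(* Freeness keeps the start vector (a0, 1) off both eigenlines; these are the cases z = 1 and z =
   -1. *)
have nz (z : int) : z != 0 -> a0 + X * z%:~R != 0.
  move=> z0; apply: contra_neq z0 => h.
  have [_ /eqP] := Zadj_free R m _ _ A0 (Zadj_intr _ _ z) h.
  by rewrite intr_eq0 => /eqP.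
have [P0 Q0] : P 0%N = a0 /\ Q 0%N = 1.
  by rewrite /P /Q /cf_num /cf_den !cf_mx0 !mxE.
apply: (pell_orbit_cvg_gt0 _ X p a1 P Q X0 N1) => //.
- move=> k; rewrite /P /Q doubleS.
  have [-> ->] := cf_seq12_period _ a0 a1 a2 k.*2.
  rewrite -/c; move: (cf_num c _) (cf_den c _) => u v.
  by rewrite X2 a2E /p; split; ring.
- by rewrite P0 Q0; exact: (nz 1).
- by rewrite P0 Q0 -mulrN; exact: (nz (-1)).
Qed.
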